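(* Let $\alpha=(\alpha_1,\dots,\alpha_\ell)$ be a composition and $\lambda=(\lambda_1,\dots,\lambda_\ell)$ a partition, both of length $\ell$, and let $M_{\alpha/\lambda}$ be the $\ell\times\ell$ matrix with $(i,j)$ entry $H_{(\alpha_i-i)-(\lambda_j-j)}$ (entries regarded as formal symbols $H_d$ with integer subscript $d$). Suppose: (1) for every $k\in\{1,\dots,\ell\}$ and every set $S$ of $k$ rows of $M_{\alpha/\lambda}$, at least one row in $S$ contains at least $k$ entries with nonnegative subscript; and (2) whenever two distinct rows $i\neq j$ of $M_{\alpha/\lambda}$ are identical, no entry of these rows is $H_0$. Then $\mathfrak{S}_{\alpha/\lambda}\neq0$ in $\mathrm{NSym}$.
   Context: A composition is a finite sequence of positive integers; a partition is a weakly decreasing sequence of positive integers. $\mathrm{NSym}$ is the free associative algebra over $\mathbb{R}$ generated by noncommuting $H_1,H_2,\dots$ (no relations), with conventions $H_0=1$ and $H_a=0$ for $a<0$; the products $H_\gamma=H_{\gamma_1}\cdots H_{\gamma_m}$ over compositions $\gamma$ form a basis. The skew immaculate function is $\mathfrak{S}_{\alpha/\lambda}=\operatorname{ndet}(M_{\alpha/\lambda})=\sum_{\sigma\in S_\ell}\operatorname{sgn}(\sigma)M_{1,\sigma(1)}M_{2,\sigma(2)}\cdots M_{\ell,\sigma(\ell)}$ (Laplace expansion starting in the top row and proceeding sequentially to the bottom row). *)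

(* Defs.v *)
From mathcomp Require Import all_boot all_order all_algebra all_fingroup.
From mathcomp Require Import reals monalg.

Set Implicit Arguments.
Unset Strict Implicit.
Unset Printing Implicit Defensive.

Import GRing.Theory.

Local Open Scope ring_scope.

Definition is_composition (s : seq nat) : bool := all (leq 1) s.

Definition is_partition (s : seq nat) : bool := all (leq 1) s && sorted geq s.

(* The free associative algebra, as the monoid algebra of the free monoid on
   nat; the letter n of that monoid stands for the generator H_{n+1}. *)
Notation NSym R := {malg R[{fmonom nat}]}.

Definition H (R : realType) (d : int) : NSym R :=
  match d with
  | Posz 0 => 1
  | Posz n.+1 => << fmu n >>
  | Negz _ => 0
  end.

(* The subscripts of M_{alpha/lambda}. The 0-based indices shift i and j
   simultaneously, so (alpha_i - i) - (lambda_j - j) is unchanged. *)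
Definition subscript_mx (l : nat) (alpha lambda : l.-tuple nat) : 'M[int]_l :=
  \matrix_(i, j) (((tnth alpha i)%:Z - i%:Z) - ((tnth lambda j)%:Z - j%:Z)).

Definition skew_mx (R : realType) (l : nat) (alpha lambda : l.-tuple nat) :
    'M[NSym R]_l :=
  map_mx (@H R) (subscript_mx alpha lambda).

(* The product over i : 'I_l is taken in increasing order of the rows. *)
Definition ndet (A : pzRingType) (l : nat) (M : 'M[A]_l) : A :=
  \sum_(s : 'S_l) (-1) ^+ s * \prod_(i < l) M i (s i).

Definition skew_immaculate (R : realType) (l : nat)
    (alpha lambda : l.-tuple nat) : NSym R :=
  ndet (skew_mx R alpha lambda).

(* Main.v *)
Require Import Defs.
From mathcomp Require Import all_boot all_order all_algebra all_fingroup.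
From mathcomp Require Import reals monalg.
From mathcomp Require Import zify.

Import Order.TTheory GRing.Theory Num.Theory.

Local Open Scope ring_scope.

(** Put [a_i = alpha_i - i] and [b_j = lambda_j - j]; the [b_j] are strictly
    decreasing. Match the row with the p-th largest [a] to column p. Condition
    (1) makes all subscripts of this matching nonnegative. If the subscript at
    column p is 0, then condition (2) shows that the rows with [a_i >= b_p] are
    exactly the p rows matched to columns 1..p, so every permutation with
    nonnegative subscripts must use this same zero entry. A permutation giving
    the same word therefore has at least these zeros; as the words have the
    same length it has no others, so it has the same subscript in every row and
    is the chosen one. The coefficient of that word is thus 1 or -1. *)

(** The letter [n] stands for H_{n+1}, so H_0 = 1 is the empty word. Negative subscripts get the
    empty word only as a default, so words determine subscripts only among nonnegative ones. *)
Definition H_word (d : int) : seq nat :=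
  if d is Posz n.+1 then [:: n] else [::].

Lemma H_word_inj (d e : int) :
  0 <= d -> 0 <= e -> H_word d = H_word e -> d = e.
Proof. by case: d => [[|m]|m] //; case: e => [[|n]|n] // _ _ [->]. Qed.

Lemma prod_H (R : realType) (I : Type) (r : seq I) (d : I -> int) :
  \prod_(i <- r) H R (d i) =
  if all (fun i => 0 <= d i) r
  then << FMonom (flatten [seq H_word (d i) | i <- r]) >> else 0.
Proof.
elim: r => [|i r IH] /=.
  by rewrite big_nil; congr << _ *g _ >>; apply: val_inj; rewrite /= fm1.
rewrite big_cons IH; case: (d i) => [[|n]|n] /=; last by rewrite mul0r.
  by rewrite mul1r.
case: ifP => _; last by rewrite mulr0.
rewrite malgM_def fgmulUU mulr1; congr << _ *g _ >>; apply: val_inj.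
by rewrite /= fmM fmU.
Qed.

Lemma leq_size_flatten_map (I T : Type) (r : seq I) (f g : I -> seq T) :
  (forall i, size (f i) <= size (g i))%N ->
  (size (flatten (map f r)) <= size (flatten (map g r)))%N.
Proof.
by move=> le_fg; elim: r => //= i r IH; rewrite !size_cat leq_add.
Qed.

(** The total lengths agree and no block of [f] is longer than that of [g], so corresponding blocks
    have equal length and both words are cut at the same places. *)
Lemma flatten_map_inj (I : Type) (T : eqType) (r : seq I) (f g : I -> seq T) :
  (forall i, size (f i) <= size (g i))%N ->
  flatten (map f r) = flatten (map g r) -> map f r = map g r.
Proof.
move=> le_fg; elim: r => //= i r IH eq_fg.
have le_r := @leq_size_flatten_map _ _ r _ _ le_fg.
have size_fg : size (f i) = size (g i).
  by move: (congr1 size eq_fg) (le_fg i); rewrite !size_cat; lia.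
by move/eqP: eq_fg; rewrite eqseq_cat // => /andP[/eqP-> /eqP/IH ->].
Qed.

(** Provides the matching: [rho] sends a column to its row, so the permutation that enters the
    determinant is its inverse. *)
Lemma sorting_perm (l : nat) (a : 'I_l -> int) :
  {rho : 'S_l | forall p q : 'I_l, (p <= q)%N -> a (rho q) <= a (rho p)}.
Proof.
pose ge_a := [rel i j | a j <= a i].
have size_s : size (sort ge_a (enum 'I_l)) == l.
  by rewrite size_sort size_enum_ord.
pose s := Tuple size_s.
have inj_s : injective (tnth s).
  apply/injectiveP; rewrite /injectiveb /dinjectiveb map_tnth_enum sort_uniq.
  exact: enum_uniq.
exists (perm inj_s) => p q le_pq; rewrite !permE !(tnth_nth p).
have tr : transitive ge_a by move=> x y z /= h1 h2; apply: le_trans h2 h1.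
have rf : reflexive ge_a by move=> x /=.
have tot : total ge_a by move=> x y /=; apply: le_total.
apply: (sorted_leq_nth tr rf p (sort_sorted tot _)) => //;
  by rewrite inE (eqP size_s).
Qed.

Section SortedMatching.

Variables (l : nat) (a b : 'I_l -> int) (rho : 'S_l).
Hypothesis b_decr : forall p q : 'I_l, (p < q)%N -> b q < b p.
Hypothesis a_sorted : forall p q : 'I_l, (p <= q)%N -> a (rho q) <= a (rho p).

Lemma b_nonincr (p q : 'I_l) : (p <= q)%N -> b q <= b p.
Proof. by case: ltngtP => // [/b_decr/ltW //|/val_inj->]. Qed.

Lemma sorted_matching_ge (p : 'I_l) :
  (forall S : {set 'I_l}, S != set0 ->
     exists2 i, i \in S & (#|S| <= #|[set j | (b j <= a i)%R]|)%N) ->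
  b p <= a (rho p).
Proof.
move=> hall.
(* If [a (rho p) < b p], every row at a sorted position in [Q] has its nonnegative subscripts
   strictly right of column [p], hence fewer than [#|Q|] of them. *)
pose Q := [set q : 'I_l | (p <= q)%N].
have cardS : #|rho @: Q| = #|Q| by apply: card_imset; apply: perm_inj.
have pQ : p \in Q by rewrite inE.
have [|i /imsetP[q]] := hall (rho @: Q).
  by rewrite -card_gt0 cardS; apply/card_gt0P; exists p.
rewrite inE => le_pq -> {i}; rewrite cardS => le_card.
apply: le_trans (a_sorted _ _ le_pq); rewrite leNgt; apply/negP => lt_ab.
move: le_card; rewrite leqNgt => /negP; apply; apply: proper_card.
apply/properP; split; last by exists p => //; rewrite inE -ltNge.
apply/subsetP => j; rewrite !inE => le_ba; rewrite leqNgt; apply/negP => lt_jp.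
by move: (b_decr _ _ lt_jp); rewrite ltNge (le_trans le_ba (ltW lt_ab)).
Qed.

Lemma sorted_matching_zero_forced (tau : 'S_l) (p : 'I_l) :
  (forall i, b (tau i) <= a i) -> (forall i, a i = b p -> i = rho p) ->
  a (rho p) = b p -> tau (rho p) = p.
Proof.
move=> tau_ge uniq_p ap.
pose C := [set c : 'I_l | (c <= p)%N].
(* [f c] is the sorted position of the row that [tau] sends to column [c]. An injection of the
   finite set [C] into itself is onto, so [p] is attained. *)
pose f c := (rho^-1)%g ((tau^-1)%g c).
have inj_f : injective f by apply: inj_comp; apply: perm_inj.
have sub_f : f @: C \subset C.
  apply/subsetP => _ /imsetP[c cC ->]; rewrite inE in cC.
  rewrite inE leqNgt; apply/negP => lt_pf.
  have le_a : b p <= a (rho (f c)).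
    rewrite /f permKV; apply: le_trans (b_nonincr _ _ cC) _.
    by have := tau_ge ((tau^-1)%g c); rewrite permKV.
  have ge_a : a (rho (f c)) <= b p by rewrite -ap; apply/a_sorted/ltnW.
  have /perm_inj fp := uniq_p _ (le_anti (introT andP (conj ge_a le_a))).
  by rewrite fp ltnn in lt_pf.
have /eqP fC : f @: C == C by rewrite eqEcard sub_f card_imset /=.
have /imsetP[c] : p \in f @: C by rewrite fC inE.
rewrite inE => le_cp def_p.
have tau_p : tau (rho p) = c by rewrite {1}def_p /f !permKV.
rewrite tau_p; apply: val_inj; apply/eqP; rewrite eqn_leq le_cp /= leqNgt.
apply/negP => /b_decr; rewrite ltNge -ap.
by have := tau_ge (rho p); rewrite tau_p => ->.
Qed.

Lemma sorted_matching_word_inj (tau : 'S_l) :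
  (forall p, b p <= a (rho p)) ->
  (forall i j p, a i = b p -> a j = b p -> i = j) ->
  (forall i, b (tau i) <= a i) ->
  flatten [seq H_word (a i - b (tau i)) | i <- enum 'I_l] =
  flatten [seq H_word (a i - b ((rho^-1)%g i)) | i <- enum 'I_l] ->
  tau = (rho^-1)%g.
Proof.
move=> rho_ge uniq_zero tau_ge /flatten_map_inj eq_words.
have sig_ge i : b ((rho^-1)%g i) <= a i.
  by have := rho_ge ((rho^-1)%g i); rewrite permKV.
have inj_b : injective b.
  move=> p q eq_b; apply: val_inj.
  by case: (ltngtP p q) => // /b_decr; rewrite eq_b ltxx.
apply/permP => i; apply: inj_b.
suff /eqP: a i - b (tau i) = a i - b ((rho^-1)%g i).
  by rewrite (inj_eq (addrI _)) eqr_opp => /eqP.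
apply: H_word_inj; rewrite ?subr_ge0 //.
have/eq_in_map -> // : [seq H_word (a i - b (tau i)) | i <- enum 'I_l] =
   [seq H_word (a i - b ((rho^-1)%g i)) | i <- enum 'I_l].
  (* Block lengths: at a zero of the matching [tau] uses the same entry; elsewhere the matching
     contributes one letter, the most that [H_word] can give. *)
  apply: eq_words => {}i.
  have [ai|ne_ab] := eqVneq (a i) (b ((rho^-1)%g i)).
    have : tau (rho ((rho^-1)%g i)) = (rho^-1)%g i.
      apply: sorted_matching_zero_forced; rewrite ?permKV // => j aj.
      exact: uniq_zero aj ai.
    by rewrite permKV => ->.
  have: 0 < a i - b ((rho^-1)%g i) by rewrite subr_gt0 lt_def ne_ab sig_ge.
  by case: (a i - b _) => [[|n]|n] // _; case: (_ - _) => [[|?]|?].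
by rewrite mem_enum.
Qed.

End SortedMatching.

Theorem theorem6 (R : realType) (l : nat) (alpha lambda : l.-tuple nat)
    (alpha_comp : is_composition alpha)
    (lambda_part : is_partition lambda)
    (rows_nonneg : forall k : nat, (1 <= k <= l)%N ->
       forall S : {set 'I_l}, #|S| = k ->
       exists2 i : 'I_l, i \in S &
         (k <= #|[set j : 'I_l | (0 <= subscript_mx alpha lambda i j)%R]|)%N)
    (rows_identical : forall i j : 'I_l, i <> j ->
       row i (subscript_mx alpha lambda) = row j (subscript_mx alpha lambda) ->
       forall m : 'I_l, subscript_mx alpha lambda i m <> 0) :
  skew_immaculate R alpha lambda <> 0.
Proof.
pose a (i : 'I_l) : int := (tnth alpha i)%:Z - i%:Z.
pose b (j : 'I_l) : int := (tnth lambda j)%:Z - j%:Z.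
have subE i j : subscript_mx alpha lambda i j = a i - b j by rewrite mxE.
have b_decr (p q : 'I_l) : (p < q)%N -> b q < b p.
  move=> lt_pq; have /andP[_ s_lambda] := lambda_part.
  have : (tnth lambda q <= tnth lambda p)%N.
    have tr : transitive geq by move=> x y z /= h1 h2; apply: leq_trans h2 h1.
    rewrite !(tnth_nth 0%N).
    have := @sorted_leq_nth _ geq tr leqnn 0%N _ s_lambda p q.
    by rewrite !inE size_tuple !ltn_ord; apply=> //; apply: ltnW.
  by rewrite /b; lia.
have hall (S : {set 'I_l}) : S != set0 ->
    exists2 i, i \in S & (#|S| <= #|[set j | (b j <= a i)%R]|)%N.
  move=> S_neq0; have [|i iS le_S] := rows_nonneg #|S| _ S erefl.
    by rewrite card_gt0 S_neq0 -[X in (_ <= X)%N]card_ord max_card.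
  exists i => //; apply: leq_trans le_S _; apply/subset_leq_card/subsetP => j.
  by rewrite !inE subE subr_ge0.
have uniq_zero i j p : a i = b p -> a j = b p -> i = j.
  (* Rows with equal [a] are identical, and here they would contain H_0 in column [p]. *)
  move=> ai aj; apply/eqP/negPn/negP => /eqP neq_ij.
  have := rows_identical _ _ neq_ij; move=> /(_ _ p); rewrite subE ai subrr.
  by apply=> //; apply/rowP => k; rewrite !mxE -/(a i) -/(a j) ai aj.
have [rho a_sorted] := sorting_perm l a.
have rho_ge p : b p <= a (rho p) by apply: sorted_matching_ge.
pose word (tau : 'S_l) :=
  FMonom (flatten [seq H_word (a i - b (tau i)) | i <- enum 'I_l]).
pose nonneg (tau : 'S_l) := all (fun i => 0 <= a i - b (tau i)) (enum 'I_l).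
have termE (tau : 'S_l) : \prod_(i < l) skew_mx R alpha lambda i (tau i) =
    if nonneg tau then << word tau >> else 0.
  rewrite -prod_H enumT [index_enum _]unlock; apply: eq_bigr => i _.
  by rewrite mxE subE.
have nonnegP tau : nonneg tau -> forall i, b (tau i) <= a i.
  by move=> /allP h i; rewrite -subr_ge0 h ?mem_enum.
have nonneg_rho : nonneg (rho^-1)%g.
  apply/allP => i _; rewrite subr_ge0.
  by have := rho_ge ((rho^-1)%g i); rewrite permKV.
move/(congr1 (mcoeff (word (rho^-1)%g))).
rewrite mcoeff0 /skew_immaculate /ndet raddf_sum /= (bigD1 (rho^-1)%g) //=.
(* Any other [tau] contributes 0 to this coefficient: a negative subscript kills its product, or its
   word is different. *)
rewrite [X in _ + X]big1 ?addr0 => [|tau neq_tau].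
  rewrite termE nonneg_rho -signr_odd mulr_sign.
  by case: odd; rewrite ?mcoeffN mcoeffUU => /eqP; rewrite ?oppr_eq0 oner_eq0.
rewrite termE; case: ifP => [nn_tau|_]; last by rewrite mulr0 mcoeff0.
have coef0 : (<< word tau >> : NSym R)@_(word (rho^-1)%g) = 0.
  rewrite mcoeffU; case: eqP => // -[eq_word].
  case/eqP: neq_tau; apply: sorted_matching_word_inj eq_word => //.
  exact: nonnegP.
by rewrite -signr_odd mulr_sign; case: odd; rewrite ?mcoeffN coef0 ?oppr0.
Qed.
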